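(* Let $\mathcal F$ be a group pair with $U$ and $A$ as in the context. For each $x\in I$ the following conditions are equivalent: (i) the identity relation $\mathrm{id}_{G_x}=\{(g,g):g\in G_x\}$ belongs to $A$; (ii) $R_{xx,0}=\mathrm{id}_{G_x}$; (iii) $\varphi_{xx}$ is the identity automorphism of $G_x/\{e_x\}$. Consequently, $A$ contains the identity relation $\mathrm{id}_U$ on $U$ if and only if (iii) holds for every $x\in I$.
   Context: A group pair $\mathcal F=(\langle G_x:x\in I\rangle,\langle\varphi_{xy}:(x,y)\in\mathcal E\rangle)$ consists of the following data. - A system of pairwise disjoint groups $G_x$ ($x\in I$), with operation $\circ$ and identity $e_x$. - An equivalence relation $\mathcal E$ on $I$. - For each $(x,y)\in\mathcal E$, a group isomorphism $\varphi_{xy}$ from $G_x/H_{xy}$ onto $G_y/K_{xy}$, where $H_{xy}\trianglelefteq G_x$ and $K_{xy}\trianglelefteq G_y$. Write $X\circ Y=\{a\circ b:a\in X,b\in Y\}$. For each $(x,y)\in\mathcal E$ fix an enumeration without repetitions $\langle H_{xy,\gamma}:\gamma<\kappa_{xy}\rangle$ of the cosets of $H_{xy}$ in $G_x$, with $H_{xy,0}=H_{xy}$, and put $K_{xy,\gamma}=\varphi_{xy}(H_{xy,\gamma})$. Define: - $R_{xy,\alpha}=\bigcup_{\gamma<\kappa_{xy}}H_{xy,\gamma}\times(K_{xy,\gamma}\circ K_{xy,\alpha})$; - $U=\bigcup_{x\in I}G_x$; - $A$ = the set of all unions of subfamilies of $\{R_{xy,\alpha}:(x,y)\in\mathcal E,\alpha<\kappa_{xy}\}$.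 *)

(* Defs.v *)
From mathcomp Require Import all_boot all_classical.
From mathcomp Require Import wochoice.

Set Implicit Arguments.
Unset Strict Implicit.
Unset Printing Implicit Defensive.

Local Open Scope classical_set_scope.
Local Open Scope group_scope.

(* The groups may be infinite, so G / H is handled through its elements, the
   cosets of H, which are multiplied by the setwise product [cmul]. *)
Section Quotients.
Variable G : groupType.

Definition cmul (X Y : set G) : set G := [set a * b | a in X & b in Y].

Definition normal_subgroup (H : set G) : Prop :=
  group_closed (mem H) /\ (forall g h : G, H h -> H (h ^ g)).

Definition cosets (H : set G) : set (set G) :=
  range (fun g : G => [set g * h | h in H]).

End Quotients.

Definition quotient_isomorphism (G G' : groupType) (H : set G) (K : set G')
    (f : set G -> set G') : Prop :=
  set_bij (cosets H) (cosets K) f /\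
  (forall X Y, cosets H X -> cosets H Y -> f (cmul X Y) = cmul (f X) (f Y)).

Unset Implicit Arguments.

(* [gp_H], [gp_K] and [gp_phi] are constrained only on pairs related by [gp_E];
   and only such pairs enter the set [A] below.  Likewise [gp_phi x y] matters only on
   the cosets of [gp_H x y]. *)
Record group_pair := GroupPair {
  gp_I : Type;
  gp_G : gp_I -> groupType;
  gp_E : gp_I -> gp_I -> Prop;
  gp_H : forall x y : gp_I, set (gp_G x);
  gp_K : forall x y : gp_I, set (gp_G y);
  gp_phi : forall x y : gp_I, set (gp_G x) -> set (gp_G y);
  gp_E_equiv : RelationClasses.Equivalence gp_E;
  gp_H_normal : forall x y, gp_E x y -> normal_subgroup (gp_H x y);
  gp_K_normal : forall x y, gp_E x y -> normal_subgroup (gp_K x y);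
  gp_phi_iso : forall x y, gp_E x y ->
    quotient_isomorphism (gp_H x y) (gp_K x y) (gp_phi x y)
}.

Arguments gp_G {_}.
Arguments gp_E {_}.
Arguments gp_H {_}.
Arguments gp_K {_}.
Arguments gp_phi {_}.

(* The ordinals below kappa_xy form a well-ordered type with least element 0. *)
Record coset_enumeration (F : group_pair) := CosetEnumeration {
  kappa : gp_I F -> gp_I F -> Type;
  kappa_le : forall x y, rel (kappa x y);
  kappa0 : forall x y, kappa x y;
  Hcoset : forall x y, kappa x y -> set (gp_G x);
  kappa_wo : forall x y, gp_E x y -> well_order (kappa_le x y);
  kappa0_le : forall x y, gp_E x y -> forall c, kappa_le x y (kappa0 x y) c;
  Hcoset_bij : forall x y, gp_E x y ->
    set_bij [set: kappa x y] (cosets (gp_H x y)) (Hcoset x y);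
  Hcoset0 : forall x y, gp_E x y -> Hcoset x y (kappa0 x y) = gp_H x y
}.

Arguments kappa {_}.
Arguments kappa0 {_}.
Arguments Hcoset {_} _ {_ _}.

Set Implicit Arguments.

Section Relations.
Variable F : group_pair.

(* Tagging elements by their index makes the groups pairwise disjoint;
   [copy x X] is the subset X of the group G_x seen in the common universe. *)
Definition point : Type := {x : gp_I F & gp_G x}.

Definition copy (x : gp_I F) (X : set (gp_G x)) : set point :=
  [set existT (fun x => gp_G x : Type) x g | g in X].

Definition U : set point := \bigcup_x copy [set: gp_G x].

Definition id_on (X : set point) : set (point * point) :=
  [set (u, u) | u in X].

Variable c : coset_enumeration F.

Definition Kcoset (x y : gp_I F) (g : kappa c x y) : set (gp_G y) :=
  gp_phi x y (Hcoset c g).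

Definition R (x y : gp_I F) (a : kappa c x y) : set (point * point) :=
  \bigcup_(g in [set: kappa c x y])
    (copy (Hcoset c g) `*` copy (cmul (Kcoset g) (Kcoset a))).

Definition R_family : set (set (point * point)) :=
  [set S | exists x y (a : kappa c x y), gp_E x y /\ S = R a].

Definition A : set (set (point * point)) :=
  [set S | exists2 P, P `<=` R_family & S = \bigcup_(T in P) T].

End Relations.

(* phi_xx is an automorphism of G_x / {e_x} only if H_xx = K_xx = {e_x}. *)
Definition phi_is_identity_mod_trivial (F : group_pair) (x : gp_I F) : Prop :=
  [/\ gp_H x x = [set 1], gp_K x x = [set 1] &
      forall X, cosets [set (1 : gp_G x)] X -> gp_phi x x X = X].

(* Main.v *)
(** The diagonal contains the pair of identities of [G_x]; a relation
    [R_{yz,a}] below the diagonal that contains this pair must have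
    [x = y = z], and [1 \in K \o K_a] forces [K_a = K], hence [a = 0].  So the
    only member of the family able to cover that pair is [R_{xx,0}]. *)
Require Import Defs.
From mathcomp Require Import all_boot all_classical.
From Stdlib Require Import Eqdep.

Local Open Scope classical_set_scope.

(** * Cosets of a normal subgroup, as sets *)

Section Cosets.
Local Open Scope group_scope.
Variables (G : groupType) (H : set G).
Hypothesis nH : normal_subgroup H.

Lemma normal_subgroup1 : H 1.
Proof. by case: nH => -[+ _] _; rewrite inE. Qed.

Lemma normal_subgroup_div (a b : G) : H a -> H b -> H (a / b).
Proof.
case: nH => -[_ hd] _ Ha Hb; apply: set_mem.
by apply: hd; rewrite in_setE.
Qed.

Lemma normal_subgroupV (a : G) : H a -> H a^-1.
Proof.
move=> Ha; rewrite -[a^-1]mul1g.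
exact: normal_subgroup_div normal_subgroup1 Ha.
Qed.

Lemma normal_subgroupM (a b : G) : H a -> H b -> H (a * b).
Proof.
move=> Ha Hb; rewrite -[b]invgK.
exact: normal_subgroup_div Ha (normal_subgroupV _ Hb).
Qed.

Lemma coset_normal_subgroup (a : G) : H a -> [set a * h | h in H] = H.
Proof.
move=> Ha; apply/seteqP; split=> [_ [h Hh <-]|h Hh].
  exact: normal_subgroupM.
exists (a^-1 * h); last by rewrite mulVKg.
exact: normal_subgroupM (normal_subgroupV _ Ha) Hh.
Qed.

Lemma cosets_normal_subgroup : cosets H H.
Proof. by exists 1 => //; apply: coset_normal_subgroup normal_subgroup1. Qed.

Lemma coset_nonempty (X : set G) : cosets H X -> X !=set0.
Proof. by case=> a _ <-; exists (a * 1), 1 => //; exact: normal_subgroup1. Qed.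

Lemma cmul_coset (X : set G) : cosets H X -> cmul X H = X.
Proof.
case=> a _ <-; apply/seteqP; split=> [_ [_ [h Hh <-] [k Hk <-]]|_ [h Hh <-]].
  by exists (h * k); [exact: normal_subgroupM | rewrite mulgA].
exists (a * h); first by exists h.
by exists 1; [exact: normal_subgroup1 | rewrite mulg1].
Qed.

(** If [k * (a * h) = 1] with [k], [h] in [H], then [a = k^-1 / h] lies in [H], so its coset is [H]
    itself. *)
Lemma coset_eq_subgroup (X : set G) : cosets H X -> cmul H X 1 -> X = H.
Proof.
case=> a _ <- [k Hk [_ [h Hh <-]] kah1]; apply: coset_normal_subgroup.
move/(canRL (mulKg k))/(canRL (mulgK h)): kah1; rewrite mulg1 => ->.
exact: normal_subgroup_div (normal_subgroupV _ Hk) Hh.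
Qed.

Lemma coset_of_elt (a : G) : exists2 X, cosets H X & X a.
Proof.
exists [set a * h | h in H]; first by exists a.
by exists 1; [exact: normal_subgroup1 | rewrite mulg1].
Qed.

End Cosets.

(** By surjectivity [K = f X] for some coset [X]; multiplying [K] by [f H] gives
    [f (cmul X H) = f X = K], which contains 1, so [coset_eq_subgroup] applies to [f H]. *)
Lemma quotient_isomorphism1 (G G' : groupType) (H : set G) (K : set G') f :
  normal_subgroup H -> normal_subgroup K -> quotient_isomorphism H K f ->
  f H = K.
Proof.
move=> nH nK [[fhom _ fsurj] fM]; have cK := cosets_normal_subgroup _ _ nK.
have cH := cosets_normal_subgroup _ _ nH.
apply: (coset_eq_subgroup _ _ nK) => //; first exact: fhom.
have [X cX fX] := fsurj _ cK.
rewrite -{1}fX -fM // cmul_coset // fX; exact: normal_subgroup1.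
Qed.

(** * Tagged points and coset indices *)

Section Diagonals.
Local Open Scope group_scope.
Variables (F : group_pair) (c : coset_enumeration F).
Implicit Types x y z : gp_I F.

Definition inj_point x (g : gp_G x) : Defs.point F :=
  existT (fun x => gp_G x : Type) x g.

(** The index type is arbitrary, so equality of tagged elements is turned into equality of elements
    by the axiom behind [inj_pair2]. *)
Lemma copyP x (X : set (gp_G x)) (g : gp_G x) : copy X (inj_point x g) <-> X g.
Proof.
by split=> [[h Xh /(@inj_pair2 _ _ _ _ _) <- //]|Xg]; exists g.
Qed.

Lemma id_onP (X : set (Defs.point F)) (u v : Defs.point F) :
  id_on X (u, v) <-> X u /\ u = v.
Proof. by split=> [[w Xw [<- <-]]|[Xu <-]]; [|exists u]. Qed.

Lemma gp_E_refl x : gp_E x x.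
Proof. by have [r _ _] := gp_E_equiv F; exact: r. Qed.

Lemma cosets_Hcoset {x y} (g : kappa c x y) :
  gp_E x y -> cosets (gp_H x y) (Hcoset c g).
Proof. by move=> /(Hcoset_bij _ c) [h _ _]; exact: h. Qed.

Lemma cosets_Kcoset {x y} (g : kappa c x y) :
  gp_E x y -> cosets (gp_K x y) (Kcoset g).
Proof.
move=> Exy; have [[h _ _] _] := gp_phi_iso F _ _ Exy.
by apply: h; exact: cosets_Hcoset.
Qed.

Lemma Kcoset0 x y : gp_E x y -> Kcoset (kappa0 c x y) = gp_K x y.
Proof.
move=> Exy; rewrite /Kcoset Hcoset0 //.
exact: quotient_isomorphism1 (gp_H_normal F _ _ Exy) (gp_K_normal F _ _ Exy)
  (gp_phi_iso F _ _ Exy).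
Qed.

Lemma Hcoset_cover {x y} (a : gp_G x) :
  gp_E x y -> exists g : kappa c x y, Hcoset c g a.
Proof.
move=> Exy; have [X cX Xa] := coset_of_elt _ _ (gp_H_normal F _ _ Exy) a.
have [_ _ /(_ _ cX) [g _ gX]] := Hcoset_bij _ c _ _ Exy.
by exists g; rewrite gX.
Qed.

Lemma kappa0_unique {x y} (g : kappa c x y) :
  gp_E x y -> Hcoset c g = gp_H x y -> g = kappa0 c x y.
Proof.
move=> Exy; have [_ inj _] := Hcoset_bij _ c _ _ Exy.
by rewrite -(Hcoset0 _ c _ _ Exy) => /inj; apply; rewrite inE.
Qed.

(** Both [gp_phi] on cosets and the enumeration are injective, so distinct indices have distinct
    image cosets. *)
Lemma Kcoset_inj {x y} (g : kappa c x y) :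
  gp_E x y -> Kcoset g = gp_K x y -> g = kappa0 c x y.
Proof.
move=> Exy; rewrite -Kcoset0 // => eqK; apply: kappa0_unique => //.
rewrite -(Hcoset0 _ c _ _ Exy).
by have [[_ inj _] _] := gp_phi_iso F _ _ Exy;
  apply: inj eqK; rewrite inE; exact: cosets_Hcoset.
Qed.

(** * The relations and the diagonal *)

Lemma RP {x y} (a : kappa c x y) (g : gp_G x) (h : gp_G y) :
  R a (inj_point x g, inj_point y h) <->
  exists2 k : kappa c x y, Hcoset c k g & cmul (Kcoset k) (Kcoset a) h.
Proof.
by split=> [[k _ [/= /copyP ? /copyP ?]]|[k ? ?]]; exists k => //;
  split; apply/copyP.
Qed.

(** The factor with index 0 is [gp_K x y], which every coset absorbs on the right. *)
Lemma R0P {x y} (g : gp_G x) (h : gp_G y) : gp_E x y ->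
  R (kappa0 c x y) (inj_point x g, inj_point y h) <->
  exists2 k : kappa c x y, Hcoset c k g & Kcoset k h.
Proof.
move=> Exy; have K0 (k : kappa c x y) :
    cmul (Kcoset k) (Kcoset (kappa0 c x y)) = Kcoset k.
  rewrite Kcoset0 //; apply: cmul_coset; first exact: gp_K_normal.
  exact: cosets_Kcoset.
by rewrite RP; split=> -[k]; exists k; rewrite ?K0 // -(K0 k).
Qed.

(** Each [g] lies in some [Hcoset c k], and [Kcoset k] is nonempty, so [g] is related to some [h];
    the inclusion forces [h = g]. Hence inclusion in the diagonal already gives equality. *)
Lemma R0_sub_diagonal x : R (kappa0 c x x) `<=` id_on (U (F := F)) ->
  R (kappa0 c x x) = id_on (copy [set: gp_G x]).
Proof.
have Ex := gp_E_refl x.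
move=> sub; apply/seteqP; split=> [[u v] Ruv|_ [_ [g _ <-] <-]].
  have /id_onP[_ uv] := sub _ Ruv; apply/id_onP; split=> //.
  by case: Ruv => k _ [/= [g _ <-] _]; exists g.
have [k kg] := Hcoset_cover g Ex.
have [h kh] := coset_nonempty _ _ (gp_K_normal F _ _ Ex) _ (cosets_Kcoset k Ex).
have Rgh : R (kappa0 c x x) (inj_point x g, inj_point x h).
  by apply/R0P => //; exists k.
by have /id_onP[_ gh] := sub _ Rgh; rewrite -gh in Rgh.
Qed.

(** The bound is the diagonal of all of [U], so that covers of the identity on one group and on [U]
    are treated alike. *)
Lemma R0_of_diagonal_cover x (P : set (set (Defs.point F * Defs.point F))) :
  P `<=` R_family c ->
  \bigcup_(T in P) T `<=` id_on (U (F := F)) ->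
  (\bigcup_(T in P) T) (inj_point x 1, inj_point x 1) ->
  R (kappa0 c x x) = id_on (copy [set: gp_G x]).
Proof.
move=> PR sub [T PT]; have [y [z [a [Eyz eT]]]] := PR _ PT.
have {}sub : R a `<=` id_on (U (F := F)).
  by move=> p Rp; apply: sub; exists T => //; rewrite eT.
rewrite {}eT => R1.
have [yx zx] : y = x /\ z = x.
  by case: R1 => k _ [/= [? _ /projT1_eq /= ?] [? _ /projT1_eq /= ?]].
subst y z; case/RP: (R1) => k k1.
have H1 := normal_subgroup1 _ _ (gp_H_normal F _ _ Eyz).
(* The coset with index [k] contains 1, hence is [gp_H x x]; this turns the other membership into 1
   lying in the product of [gp_K x x] and [Kcoset a]. *)
have -> : k = kappa0 c x x.
  apply: kappa0_unique => //.
  apply: (coset_eq_subgroup _ _ (gp_H_normal F _ _ Eyz)).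
    exact: cosets_Hcoset.
  by exists 1 => //; exists 1 => //; rewrite mulg1.
rewrite Kcoset0 // => /(coset_eq_subgroup _ _ (gp_K_normal F _ _ Eyz)) aK.
have ea := Kcoset_inj _ Eyz (aK (cosets_Kcoset a Eyz)).
by apply: R0_sub_diagonal; rewrite -ea.
Qed.

Lemma id_on_subU x : id_on (copy [set: gp_G x]) `<=` id_on (U (F := F)).
Proof. by move=> _ [u xu <-]; exists u => //; exists x. Qed.

Lemma R0_identity x : R (kappa0 c x x) = id_on (copy [set: gp_G x]) <->
  phi_is_identity_mod_trivial x.
Proof.
have Ex := gp_E_refl x.
have nH := gp_H_normal F _ _ Ex; have nK := gp_K_normal F _ _ Ex.
have H1 := normal_subgroup1 _ _ nH; have K1 := normal_subgroup1 _ _ nK.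
split=> [R0|[eH eK phi1]].
  (* Each block [Hcoset c k] times [Kcoset k] lies on the diagonal; its sides are nonempty, so they
     are one and the same singleton. Index 0 gives the trivial subgroups, the other indices give
     that [gp_phi] fixes every coset. *)
  have diag (k : kappa c x x) g h : Hcoset c k g -> Kcoset k h -> g = h.
    move=> kg kh.
    have : R (kappa0 c x x) (inj_point x g, inj_point x h).
      by apply/R0P => //; exists k.
    by rewrite R0 => /id_onP [_ /(@inj_pair2 _ _ _ _ _)].
  have diag0 g h : gp_H x x g -> gp_K x x h -> g = h.
    move=> Hg Kh; apply: (diag (kappa0 c x x)).
      by rewrite Hcoset0.
    by rewrite Kcoset0.
  have eH : gp_H x x = [set 1].
    by apply/seteqP; split=> [g Hg|_ -> //]; exact: diag0.
  have eK : gp_K x x = [set 1].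
    by apply/seteqP; split=> [g Kg|_ -> //]; apply/esym/diag0.
  split=> // X; rewrite -eH => cX.
  have [_ _ /(_ _ cX) [k _ kX]] := Hcoset_bij _ c _ _ Ex.
  have [h kh] := coset_nonempty _ _ nK _ (cosets_Kcoset k Ex).
  have [g kg] := coset_nonempty _ _ nH _ cX.
  rewrite -kX in kg *; apply/seteqP; split=> l kl.
    by rewrite -(diag _ _ _ kg kl).
  by rewrite (diag _ _ _ kl kh).
apply: R0_sub_diagonal => -[u v] Ruv; apply/id_on_subU/id_onP; move: Ruv.
(* One copy of the membership is opened only to show that both points carry the tag [x], the form
   [R0P] needs. *)
move=> /[dup] -[k _ [/= [g kg <-] [h _ <-]]] /R0P-/(_ Ex) [l lg lh].
split; first exact/copyP.
have cl := cosets_Hcoset l Ex; move: lh.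
(* The coset is fixed by [gp_phi] and is the singleton of [a], so [g] and [h] both equal [a]. *)
rewrite /Kcoset phi1 -?eH //; case: cl lg => a _ <-.
by rewrite eH => -[_ -> <-] [_ -> <-].
Qed.

End Diagonals.

Theorem theorem3p4 (F : group_pair) (c : coset_enumeration F) :
  (forall x : gp_I F,
     (A c (id_on (copy [set: gp_G x])) <->
        R (kappa0 c x x) = id_on (copy [set: gp_G x])) /\
     (R (kappa0 c x x) = id_on (copy [set: gp_G x]) <->
        phi_is_identity_mod_trivial x)) /\
  (A c (id_on (U (F := F))) <->
     forall x : gp_I F, phi_is_identity_mod_trivial x).
Proof.
have R0_family x : R_family c (R (kappa0 c x x)).
  by exists x, x, (kappa0 c x x); split=> //; exact: gp_E_refl.
split=> [x|].
  split; last exact: R0_identity.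
  split=> [[P PR eP]|R0].
    apply: (R0_of_diagonal_cover _ _ _ _ PR); rewrite -eP.
      exact: id_on_subU.
    by apply/id_onP; split=> //; apply/copyP.
  exists [set R (kappa0 c x x)]; first by move=> _ ->.
  by rewrite bigcup_set1 R0.
split=> [[P PR eP] x|id_x].
  apply/(R0_identity _ c).
  apply: (R0_of_diagonal_cover _ _ _ _ PR); rewrite -eP //.
  by apply/id_onP; split=> //; exists x => //; apply/copyP.
have R0 x : R (kappa0 c x x) = id_on (copy [set: gp_G x]).
  exact/R0_identity.
(* One relation per index suffices: the identity on [U] is the union of the identities on the
   groups. *)
exists (range (fun x => R (kappa0 c x x))); first by move=> _ [x _ <-].
rewrite bigcup_image; under eq_bigcupr do rewrite R0.
apply/seteqP; split=> [_ [u [x _ xu] <-]|p [x _ /id_on_subU //]].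
by exists x => //; exists u.
Qed.
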